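(* Let $M \geq 1$ and $d \geq 2$ be integers. As $\mathcal{H}$ runs uniformly through all $d$-dimensional weak $M$-Latin hypercubes, $$ \mathbb{E}\, L_2^{\mathrm{per}}(\mathcal{H})^2 = \frac{(M-1)(M+1)^d + (2M^2+1)^d - 2^d M^{2d}}{6^d M^2}. $$ In particular, for each $d \geq 4$ and each $M$, there is a point set $X \subseteq [0,1)^d$ with $N = M^{d-1}$ points, constructed from a $d$-dimensional weak $M$-Latin hypercube, with $$ L_2^{\mathrm{per}}(X) \leq \left(\frac{d}{2\cdot 3^d}\right)^{1/2} (1+o(1))\, N^{\frac{d-2}{d-1}}, $$ where $o(1)$ depends only on $d$ and $N$ and, for fixed $d$, tends to $0$ as $N = \#X \to \infty$.
   Context: A weak $M$-Latin hypercube of dimension $d$ is a subset $\mathcal{H} \subseteq \{0,1,\dots,M-1\}^d$ such that for any $k \in \{1,\dots,d\}$ and any $m_1,\dots,m_{k-1},m_{k+1},\dots,m_d \in \{0,\dots,M-1\}$ there is exactly one $m_k \in \{0,\dots,M-1\}$ with $(m_1,\dots,m_d) \in \mathcal{H}$. The point set constructed from $\mathcal{H}$ is $X(\mathcal{H}) = \frac1M \mathcal{H} \subseteq [0,1)^d$, and $L_2^{\mathrm{per}}(\mathcal{H}) = L_2^{\mathrm{per}}(X(\mathcal{H}))$. The expectation is the average over all $d$-dimensional weak $M$-Latin hypercubes. For $x, y \in [0,1)$ the (periodic) interval is $[x,y) = \{z \in [0,1): x \leq z < y\}$ if $x<y$, and $[x,y) = \{z \in [0,1): x \leq z \text{ or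 } z < y\}$ if $x \geq y$. For $\mathbf{x}, \mathbf{y} \in [0,1)^d$ put $[\mathbf{x},\mathbf{y}) = \prod_{k=1}^d [x_k,y_k)$ and let $|[\mathbf{x},\mathbf{y})|$ be its Lebesgue measure, i.e. the product over $k$ of $y_k - x_k$ if $x_k<y_k$ and of $1-x_k+y_k$ if $x_k \geq y_k$. For a finite set $X \subseteq [0,1)^d$ with $\#X = N$ the discrepancy function is $D_X(\mathbf{x},\mathbf{y}) = \#(X \cap [\mathbf{x},\mathbf{y})) - N\,|[\mathbf{x},\mathbf{y})|$ (not normalized by $N$), and the periodic $L_2$-discrepancy (nonnegative square root) is given by $$L_2^{\mathrm{per}}(X)^2 = \int_{[0,1)^d} \int_{[0,1)^d} D_X(\mathbf{x},\mathbf{y})^2 \, d\mathbf{y}\, d\mathbf{x}.$$ *)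

(* Defs.v *)
From HB Require Import structures.
From mathcomp Require Import all_boot all_order all_algebra finmap.
From mathcomp Require Import all_classical all_reals all_analysis.

Set Implicit Arguments.
Unset Strict Implicit.
Unset Printing Implicit Defensive.

Import Order.TTheory GRing.Theory Num.Theory.
Import numFieldNormedType.Exports.

Local Open Scope classical_set_scope.
Local Open Scope ring_scope.

(* [R ^ d] is [d.-tuple R] with the product sigma-algebra.  The library has
   binary product measures only, so the d-dimensional Lebesgue measure is
   obtained by transporting [lebesgue_measure \x lebesgue_tuple d] along
   R * R ^ d -> R ^ d.+1; [lebesgue_tuple_box] characterizes it. *)
Section LebesgueTuple.
Context (R : realType).
Local Notation mR := (measurableTypeR R).

Definition cons_pair d (p : mR * d.-tuple mR) : d.+1.-tuple mR :=
  [tuple of p.1 :: p.2].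

Definition uncons_pair d (t : d.+1.-tuple mR) : mR * d.-tuple mR :=
  (thead t, [tuple of behead t]).

Lemma cons_pairK d : cancel (@cons_pair d) (@uncons_pair d).
Proof.
by move=> [x t]; congr (_, _); rewrite ?theadE//; apply/val_inj.
Qed.

Lemma measurable_cons_pair d : measurable_fun [set: _] (@cons_pair d).
Proof. by apply: (@measurable_cons _ _ _ _ fst d snd). Qed.

Lemma measurable_uncons_pair d : measurable_fun [set: _] (@uncons_pair d).
Proof.
apply/measurable_fun_pairP; split.
- exact: measurable_tnth.
- exact: measurable_behead.
Qed.

Section Step.
Local Open Scope ereal_scope.
Context d (mu : {sigma_finite_measure set (d.-tuple mR) -> \bar R}).

Definition lebesgue_step : set (d.+1.-tuple mR) -> \bar R :=
  pushforward (lebesgue_measure \x mu) (@cons_pair d).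

Let lebesgue_step0 : lebesgue_step set0 = 0.
Proof. by rewrite /lebesgue_step /pushforward preimage_set0 measure0. Qed.

Let lebesgue_step_ge0 A : 0 <= lebesgue_step A.
Proof. by rewrite /lebesgue_step /pushforward; apply: measure_ge0. Qed.

Let lebesgue_step_sigma_additive : semi_sigma_additive lebesgue_step.
Proof.
move=> F mF tF mUF; rewrite /lebesgue_step /pushforward preimage_bigcup.
apply: measure_semi_sigma_additive.
- by move=> n; rewrite -[X in measurable X]setTI; exact: measurable_cons_pair.
- apply/trivIsetP => /= i j _ _ ij; rewrite -preimage_setI.
  by move/trivIsetP : tF => /(_ _ _ _ _ ij) ->//; rewrite preimage_set0.
- rewrite -preimage_bigcup -[X in measurable X]setTI.
  exact: measurable_cons_pair.
Qed.

HB.instance Definition _ := isMeasure.Build _ _ _ lebesgue_step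
  lebesgue_step0 lebesgue_step_ge0 lebesgue_step_sigma_additive.

Let lebesgue_step_sigma_finite : sigma_finite setT lebesgue_step.
Proof.
have /sigma_finiteP[G [TG ndG Goo]] := sigma_finiteT mu.
have /sigma_finiteP[H [TH ndH Hoo]] := sigma_finiteT (@lebesgue_measure R).
exists (fun n => @uncons_pair d @^-1` (H n `*` G n)).
  rewrite -preimage_bigcup (_ : \bigcup_i _ = setT) ?preimage_setT//.
  rewrite -setXTT TH TG predeqE => -[x y]; split.
    by move=> [n _ [Hx Gy]]; split; exists n.
  move=> [[n _ Hx] [k _ Gy]]; exists (maxn n k) => //; split.
  - by have /subsetPset := ndH _ _ (leq_maxl n k); exact.
  - by have /subsetPset := ndG _ _ (leq_maxr n k); exact.
move=> k; have [mH Hk] := Hoo k; have [mG Gk] := Goo k; split.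
  rewrite -[X in measurable X]setTI.
  by apply: measurable_uncons_pair => //; exact: measurableX.
rewrite /lebesgue_step /pushforward -comp_preimage.
rewrite (_ : _ \o _ = id) ?preimage_id.
  by rewrite product_measure1E// lte_mul_pinfty// ge0_fin_numE.
by apply/funext => p /=; rewrite cons_pairK.
Qed.

HB.instance Definition _ := Measure_isSigmaFinite.Build _ _ _ lebesgue_step
  lebesgue_step_sigma_finite.

End Step.

Fixpoint lebesgue_tuple d : {sigma_finite_measure set (d.-tuple mR) -> \bar R} :=
  match d with
  | 0 => dirac [tuple]
  | d'.+1 => lebesgue_step (lebesgue_tuple d')
  end.

Lemma lebesgue_tuple_box d (A : 'I_d -> set mR) :
  (forall k, measurable (A k)) ->
  lebesgue_tuple d [set x | forall k, A k (tnth x k)] =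
  (\prod_(k < d) lebesgue_measure (A k))%E.
Proof.
elim: d A => [|d IH] A mA.
  rewrite big_ord0 /= diracE mem_set//.
  by case.
rewrite big_ord_recl -IH//=.
rewrite /lebesgue_step /pushforward -product_measure1E//; last first.
  rewrite (_ : [set _ | _] =
      \bigcap_(k in [set: 'I_d]) ((@tnth d mR)^~ k @^-1` A (lift ord0 k))).
    apply: fin_bigcap_measurable => // k _.
    rewrite -[X in measurable X]setTI.
    exact: (@measurable_tnth _ _ d k measurableT).
  by apply/seteqP; split=> x /= Ax k => [_|]; exact: Ax.
congr (_ _); apply/seteqP; split=> -[a t] /=.
  move=> At; split; first exact: (At ord0).
  by move=> k; have := At (lift ord0 k); rewrite tnthS.
move=> [Aa At] k; case: (unliftP ord0 k) => [j ->|->//].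
by rewrite tnthS; exact: At.
Qed.

End LebesgueTuple.

Section Discrepancy.
Context (R : realType).

Definition unit_cube d : set (d.-tuple (measurableTypeR R)) :=
  [set x : d.-tuple R | forall k, 0 <= tnth x k < 1].

(* Membership of z in the periodic interval [x, y) of [0, 1). *)
Definition in_per_interval (x y z : R) : bool :=
  (0 <= z < 1) && (if x < y then x <= z < y else (x <= z) || (z < y)).

Definition per_length (x y : R) : R := if x < y then y - x else 1 - x + y.

Definition in_per_box d (x y z : d.-tuple R) : bool :=
  [forall k, in_per_interval (tnth x k) (tnth y k) (tnth z k)].

Definition per_volume d (x y : d.-tuple R) : R :=
  \prod_(k < d) per_length (tnth x k) (tnth y k).

(* Not normalized by the number of points. *)
Definition discrepancy d (X : {fset d.-tuple R}) (x y : d.-tuple R) : R :=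
  #|` [fset z in X | in_per_box x y z]%fset |%:R - #|` X|%:R * per_volume x y.

Definition L2per d (X : {fset d.-tuple R}) : R :=
  Num.sqrt (fine (\int[lebesgue_tuple R d]_(x in @unit_cube d)
    \int[lebesgue_tuple R d]_(y in @unit_cube d)
      (discrepancy X x y ^+ 2)%:E)%E).

End Discrepancy.

Section LatinHypercube.
Context (R : realType) (M d : nat).
Implicit Types H : {set {ffun 'I_d -> 'I_M}}.

(* The entry [m k] is irrelevant: only the other coordinates of m matter. *)
Definition weak_latin_hypercube H : bool :=
  [forall k : 'I_d, forall m : {ffun 'I_d -> 'I_M},
    #|[set a : 'I_M | [ffun j => if j == k then a else m j] \in H]| == 1]%N.

Definition hypercube_points H : {fset d.-tuple R} :=
  [fset [tuple (m k : nat)%:R / M%:R | k < d] | m : {ffun 'I_d -> 'I_M} in H]%fset.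

Definition hypercube_mean (f : {set {ffun 'I_d -> 'I_M}} -> R) : R :=
  (\sum_(H | weak_latin_hypercube H) f H)
    / #|[set H | weak_latin_hypercube H]|%:R.

End LatinHypercube.

(* Main.v *)
Require Import Defs.
From mathcomp Require Import all_boot all_order all_algebra fingroup perm finmap.
From mathcomp Require Import all_classical all_reals all_analysis.
From mathcomp Require Import measurable_realfun ring lra zify.

Set Implicit Arguments.
Unset Strict Implicit.
Unset Printing Implicit Defensive.

Import Order.TTheory GRing.Theory Num.Theory.
Import numFieldNormedType.Exports.

Local Open Scope ring_scope.

(** The periodic L2-discrepancy is a pair energy, and its mean over all weak
Latin hypercubes only needs the probability that two given cells both belong
to the hypercube.

Pair energy.  Expanding the square of the discrepancy function of an N-point
set X gives sums over pairs of points, over points, and a constant term; each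
summand is a product over the coordinates, so its double integral over the
cube is a product of d double integrals over [0,1) ([has_integral2_prod]).
These are 1/2 - |a-b| + |a-b|^2 for two points a and b in a random arc
([has_integral2_pair]), 1/3 for a point in an arc weighted by the length of
the arc ([has_integral2_in_length]), and 1/3 for the squared length
([has_integral2_length2]).  The last two contributions combine to
- 2 N^2 / 3^d + N^2 / 3^d, which gives [L2per_sqr].

Pair probabilities.  Relabelling the symbols of one coordinate permutes the
weak Latin hypercubes, so every cell lies in a random one with probability
1/M, and the probability that p and q both do depends only on the number of
coordinates where they differ.  Letting one coordinate of q run over all
symbols, exactly one choice hits the hypercube; hence consecutive
probabilities satisfy r_j + (M-1) r_(j+1) = 1/M with r_0 = 1/M, and
r_j = 1/M^2 + (M-1)/M^2 * (-1/(M-1))^j ([pair_countE]).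

Mean.  Both parts of r_j are products over the coordinates, so the expected
energy splits into two d-th powers of one-dimensional sums, which
[sum_grid_kernel] and [sum_weighted_grid_kernel] evaluate; this is
[hypercube_mean_L2per].

Existence.  Some hypercube does not exceed the mean.  For d >= 4 the mean is
d / (2 * 3^d) * M^(2d-4) times a polynomial in 1/M with value 1 at 0
([mean_formulaE], [ratio_poly0]); as M = N^(1/(d-1)), the square root of that
polynomial minus 1 is the error term ([cvg_relative_error]). *)

(** * Integrals with values, and products over coordinates *)

Section HasIntegral.
Local Open Scope classical_set_scope.
Local Open Scope ring_scope.
Context {d : measure_display} {T : measurableType d} {R : realType}.
Context (mu : {measure set T -> \bar R}).
Implicit Types (D : set T) (f g : T -> R) (u v : R).

(** Integrability and value in one predicate, so that linear combinations need
no separate bookkeeping of integrability. *)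
Definition has_integral D f v : Prop :=
  mu.-integrable D (EFin \o f) /\ (\int[mu]_(x in D) (f x)%:E = v%:E)%E.

Lemma has_integral_ext D f g v : measurable D -> (forall x, D x -> f x = g x) ->
  has_integral D f v -> has_integral D g v.
Proof.
move=> mD fg [fi fv]; split.
  by apply: (eq_integrable mD _ _ _ fi) => x /set_mem Dx /=; rewrite fg.
by rewrite -fv; apply: eq_integral => x /set_mem Dx; rewrite fg.
Qed.

Lemma has_integralD D f g u v : measurable D ->
  has_integral D f u -> has_integral D g v ->
  has_integral D (fun x => f x + g x) (u + v).
Proof.
move=> mD [fi fu] [gi gv]; split.
  by apply: (eq_integrable mD _ _ _ (integrableD mD fi gi)) => x _ /=.
by rewrite (integralD_EFin mD fi gi) fu gv.
Qed.

Lemma has_integralZ D f v c : measurable D -> has_integral D f v ->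
  has_integral D (fun x => c * f x) (c * v).
Proof.
move=> mD [fi fv]; split.
  by apply: (eq_integrable mD _ _ _ (integrableZl mD c fi)) => x _ /=.
by rewrite EFinM -fv -(integralZl mD fi).
Qed.

Lemma has_integral0 D : measurable D -> has_integral D (fun=> 0) 0.
Proof.
by move=> mD; split; [exact: integrable0|rewrite integral0].
Qed.

Lemma has_integral_ge0 D f v : (forall x, D x -> 0 <= f x) ->
  has_integral D f v -> 0 <= v.
Proof.
move=> f0 [_ fv]; rewrite -lee_fin -fv.
by apply: integral_ge0 => x Dx; rewrite lee_fin f0.
Qed.

Lemma has_integralU A B f u v : measurable A -> measurable B ->
  [disjoint A & B] -> has_integral A f u -> has_integral B f v ->
  has_integral (A `|` B) f (u + v).
Proof.
move=> mA mB AB [fA fu] [fB fv].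
have [mfA FA] := integrableP _ _ _ fA; have [mfB FB] := integrableP _ _ _ fB.
have mf := (measurable_funU _ mA mB).2 (conj mfA mfB).
split; last by rewrite (integral_setU mu mA mB mf AB) fu fv.
apply/integrableP; split => //.
rewrite ge0_integral_setU//.
  by rewrite lte_add_pinfty.
by apply/measurableT_comp.
Qed.

(** For nonnegative functions finiteness of the value already gives
integrability; the zero extension is the form in which Tonelli's theorem and
the change of variables under a pushforward apply. *)
Lemma ge0_has_integralP D f v : measurable D -> (forall x, D x -> 0 <= f x) ->
  has_integral D f v <->
  (measurable_fun setT (((EFin \o f) \_ D) : T -> \bar R) /\
   \int[mu]_x ((EFin \o f) \_ D) x = v%:E)%E.
Proof.
move=> mD f0; rewrite -integral_mkcond; split=> [[fi fv]|[mf fv]]; split=> //.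
  by have /(integrable_mkcond _ mD)/integrableP[] := fi.
apply/integrableP; split; first exact/(measurable_restrictT _ mD).
rewrite (_ : integral _ _ _ = v%:E) ?ltry// -fv; apply: eq_integral => x /set_mem Dx /=.
by rewrite ger0_norm// f0.
Qed.

(** The iterated integral with its inner integrals named by a witness, so that
integrability is recorded at both levels and linearity is inherited from
[has_integral]. *)
Definition has_integral2 D (f : T -> T -> R) v : Prop :=
  exists g, (forall x, D x -> has_integral D (f x) (g x)) /\ has_integral D g v.

Lemma has_integral2_ext D (f g : T -> T -> R) v : measurable D ->
  (forall x y, D x -> D y -> f x y = g x y) ->
  has_integral2 D f v -> has_integral2 D g v.
Proof.
move=> mD fg [h [fh hv]]; exists h; split=> // x Dx.
by apply: has_integral_ext (fh x Dx) => // y; exact: fg.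
Qed.

Lemma has_integral2D D (f g : T -> T -> R) u v : measurable D ->
  has_integral2 D f u -> has_integral2 D g v ->
  has_integral2 D (fun x y => f x y + g x y) (u + v).
Proof.
move=> mD [F [fF Fu]] [G [gG Gv]]; exists (fun x => F x + G x).
split; last exact: has_integralD.
by move=> x Dx; apply: has_integralD; [exact: mD|exact: fF|exact: gG].
Qed.

Lemma has_integral2Z D (f : T -> T -> R) v c : measurable D ->
  has_integral2 D f v -> has_integral2 D (fun x y => c * f x y) (c * v).
Proof.
move=> mD [F [fF Fv]]; exists (fun x => c * F x).
split; last exact: has_integralZ.
by move=> x Dx; apply: has_integralZ; [exact: mD|exact: fF].
Qed.

Lemma has_integral2_sum D (I : eqType) (s : seq I) (f : I -> T -> T -> R) (v : I -> R) :
  measurable D -> (forall i, i \in s -> has_integral2 D (f i) (v i)) ->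
  has_integral2 D (fun x y => \sum_(i <- s) f i x y) (\sum_(i <- s) v i).
Proof.
move=> mD; elim: s => [|i s IH] fv.
  rewrite big_nil; exists (fun=> 0); split; last exact: has_integral0.
  move=> x _; apply: has_integral_ext (has_integral0 mD) => // y _.
  by rewrite big_nil.
rewrite big_cons; have fi : has_integral2 D (f i) (v i) by apply: fv; exact: mem_head.
have {}IH := IH (fun j js => fv j (mem_behead (s := i :: s) js)).
apply: has_integral2_ext (has_integral2D mD fi IH) => //.
by move=> x y _ _; rewrite big_cons.
Qed.

Lemma has_integral2E D (f : T -> T -> R) v : has_integral2 D f v ->
  (\int[mu]_(x in D) \int[mu]_(y in D) (f x y)%:E = v%:E)%E.
Proof.
move=> [g [fg [_ <-]]]; apply: eq_integral => x /set_mem Dx.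
by have [_ ->] := fg x Dx.
Qed.

End HasIntegral.

Section ProductIntegral.
Local Open Scope classical_set_scope.
Local Open Scope ring_scope.
Context (R : realType).
Local Notation mR := (measurableTypeR R).
Local Notation leb := (@lebesgue_measure R).
Local Notation I01 := (`[0, 1[%classic : set mR).

Lemma measurable_unit_cube d : measurable (@unit_cube R d).
Proof.
rewrite (_ : @unit_cube R d =
    \bigcap_(k in [set: 'I_d]) ((@tnth d mR)^~ k @^-1` I01)).
  apply: fin_bigcap_measurable => // k _.
  rewrite -[X in measurable X]setTI.
  by apply: (@measurable_tnth _ _ d k measurableT); exact: measurable_itv.
apply/seteqP; split=> x /= Hx k => [_|]; have := Hx k; rewrite /= in_itv//=.
by apply.
Qed.

Arguments measurable_unit_cube : clear implicits.

(** Tonelli along the recursive construction of the measure: the first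
coordinate splits off as a scalar factor, and induction handles the rest. *)
Lemma has_integral_prod d (f : 'I_d -> mR -> R) (v : 'I_d -> R) :
  (forall k x, I01 x -> 0 <= f k x) ->
  (forall k, has_integral leb I01 (f k) (v k)) ->
  has_integral (lebesgue_tuple R d) (@unit_cube R d)
    (fun x => \prod_k f k (tnth x k)) (\prod_k v k).
Proof.
have mI : measurable I01 by exact: measurable_itv.
elim: d f v => [|d IH] f v f0 fv.
  apply/ge0_has_integralP => //; first exact: measurable_unit_cube.
    by move=> x _; rewrite big_ord0.
  rewrite (_ : _ \_ _ = cst 1%E); last first.
    apply/funext => x; rewrite patchE mem_set/= ?big_ord0//.
    by case.
  split; first exact: measurable_cst.
  by rewrite integral_cst//= diracT mule1 big_ord0.
have f0' k x : I01 x -> 0 <= f (lift ord0 k) x by exact: f0.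
have /ge0_has_integralP := IH _ _ f0' (fun k => fv (lift ord0 k)).
move=> /(_ (measurable_unit_cube d)) -[].
  by move=> x Hx; apply: prodr_ge0 => k _; apply: f0; rewrite /= in_itv /=; exact: Hx.
set G := _ \_ _ => mG Gv.
have /ge0_has_integralP := fv ord0; move=> /(_ mI (f0 ord0)) -[].
set F := _ \_ _ => mF Fv.
have G0 t : (0 <= G t)%E.
  rewrite /G patchE; case: ifPn => // /set_mem Ht; rewrite lee_fin.
  by apply: prodr_ge0 => k _; apply: f0; rewrite /= in_itv /=; exact: Ht.
have F0 x : (0 <= F x)%E.
  by rewrite /F patchE; case: ifPn => // /set_mem Hx; rewrite lee_fin f0.
apply/ge0_has_integralP; first exact: measurable_unit_cube.
  by move=> x Hx; apply: prodr_ge0 => k _; apply: f0; rewrite /= in_itv /=; exact: Hx.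
set H := _ \_ _.
have HE : H = (fun x => F (thead x) * G [tuple of behead x])%E.
  apply/funext => x; rewrite /H /F /G !patchE.
  have headE : thead x = tnth x ord0 by rewrite /thead.
  have behE k : tnth [tuple of behead x] k = tnth x (lift ord0 k).
    by rewrite tnth_behead; congr tnth; apply/val_inj => /=; rewrite inordK// ltnS.
  have cubeE : (x \in @unit_cube R d.+1) =
      (thead x \in I01) && ([tuple of behead x] \in @unit_cube R d).
    apply/idP/andP; rewrite !inE /=.
      move=> Hx; split; first by rewrite in_itv /= headE; exact: Hx.
      by move=> k; rewrite behE; exact: Hx.
    move=> [Hx Ht] k; case: (unliftP ord0 k) => [j ->|->].
      by rewrite -behE; exact: Ht.
    by rewrite -headE; rewrite in_itv in Hx.
  rewrite cubeE; case: (thead x \in _) => /=; last by rewrite mul0e.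
  case: (_ \in _); last by rewrite mule0.
  rewrite -EFinM big_ord_recl headE; congr (_ * _)%:E.
  by apply: eq_bigr => k _; rewrite behE.
have mH : measurable_fun setT H.
  rewrite HE; apply: emeasurable_funM.
    exact: (measurableT_comp mF (measurable_tnth ord0)).
  by apply/(measurableT_comp mG); exact: measurable_behead.
split=> //.
rewrite (ge0_integral_pushforward (@measurable_cons_pair R d) _ measurableT mH); last first.
  by move=> y _; rewrite HE; apply: mule_ge0.
rewrite preimage_setT fubini_tonelli1; last 2 first.
- exact: measurableT_comp mH (@measurable_cons_pair R d).
- by move=> y; rewrite /= HE; apply: mule_ge0.
rewrite big_ord_recl EFinM -Fv /fubini_F.
transitivity (\int[leb]_x (F x * (\prod_(i < d) v (lift ord0 i))%:E))%E.
  apply: eq_integral => x _; rewrite -Gv -ge0_integralZl//.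
  apply: eq_integral => y _; rewrite /comp HE; congr (_ * G _)%E.
  exact/val_inj.
rewrite ge0_integralZr// lee_fin.
by rewrite -lee_fin -Gv; apply: integral_ge0.
Qed.

(** The inner integrals are again products of nonnegative functions of one
coordinate, so [has_integral_prod] applies twice. *)
Lemma has_integral2_prod d (f : 'I_d -> mR -> mR -> R) (v : 'I_d -> R) :
  (forall k x y, I01 x -> I01 y -> 0 <= f k x y) ->
  (forall k, has_integral2 leb I01 (f k) (v k)) ->
  has_integral2 (lebesgue_tuple R d) (@unit_cube R d)
    (fun x y => \prod_k f k (tnth x k) (tnth y k)) (\prod_k v k).
Proof.
move=> f0 /choice[g fg].
have cubeP (x : d.-tuple mR) k : @unit_cube R d x -> I01 (tnth x k).
  by move=> Hx; rewrite /= in_itv /=; exact: Hx.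
exists (fun x => \prod_k g k (tnth x k)); split.
  move=> x Hx; apply: (@has_integral_prod d (fun k => f k (tnth x k))).
    by move=> k y Hy; apply: f0 => //; exact: cubeP.
  by move=> k; apply: (fg k).1; exact: cubeP.
apply: has_integral_prod => k; last exact: (fg k).2.
by move=> x Ix; apply: has_integral_ge0 ((fg k).1 x Ix) => y; exact: f0.
Qed.

End ProductIntegral.

(** * Double integrals over arcs of the circle *)

Section IntervalIntegral.
Local Open Scope classical_set_scope.
Local Open Scope ring_scope.
Context (R : realType).
Local Notation mR := (measurableTypeR R).
Local Notation leb := (@lebesgue_measure R).
Local Notation I01 := (`[0, 1[%classic : set mR).
Implicit Types (f : mR -> R) (a b c : R).

(** Open intervals are used because the integrands below are piecewise
polynomial with jumps, and their formulas hold only between breakpoints. *)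
Lemma has_integral_deriv (p : {poly R}) a b : a <= b ->
  has_integral leb `]a, b[%classic (horner p^`()) (p.[b] - p.[a]).
Proof.
rewrite le_eqVlt => /predU1P[->|ab].
  rewrite set_itv_ge ?bnd_simp ?ltxx// subrr; split; last by rewrite integral_set0.
  exact: integrable_set0.
have cp' : {within `[a, b], continuous (horner p^`())}.
  by apply: continuous_subspaceT => x; exact: continuous_horner.
have ip : leb.-integrable `[a, b] (EFin \o horner p^`()).
  by apply: continuous_compact_integrable cp'; exact: segment_compact.
have sub : `]a, b[ `<=` `[a, b] by apply: subset_itvW.
split; first by apply: integrableS ip.
have mp (A : set mR) : measurable A -> measurable_fun A (EFin \o horner p^`()).
  by move=> mA; apply: measurableT_comp => //; exact: measurable_poly.
rewrite integral_itv_obnd_cbnd; last by apply: mp; exact: measurable_itv.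
rewrite integral_itv_bndo_bndc; last by apply: mp; exact: measurable_itv.
rewrite (continuous_FTC2 (F := horner p) ab cp')//.
  split=> [x _||]; first exact: derivable_horner.
  - by apply: cvg_at_right_filter; exact: continuous_horner.
  - by apply: cvg_at_left_filter; exact: continuous_horner.
by move=> x _; rewrite derivE.
Qed.

Lemma has_integral_set1 f a : has_integral leb [set a] f 0.
Proof.
split; last exact: integral_set1.
apply: null_set_integrable => //; first exact: measurable_fun_set1.
exact: lebesgue_measure_set1.
Qed.

(** The breakpoint b is a null set, so whatever f does there is harmless. *)
Lemma has_integral_cat b a c f u v : a <= b -> b <= c ->
  has_integral leb `]a, b[%classic f u -> has_integral leb `]b, c[%classic f v ->
  has_integral leb `]a, c[%classic f (u + v).
Proof.
move=> ab bc fu fv.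
move: ab; rewrite le_eqVlt => /predU1P[eab|ab].
  move: fu; rewrite eab set_itv_ge ?bnd_simp ?ltxx// => -[_].
  by rewrite integral_set0 => -[<-]; rewrite add0r.
move: bc; rewrite le_eqVlt => /predU1P[ebc|bc].
  move: fv; rewrite -ebc set_itv_ge ?bnd_simp ?ltxx// => -[_].
  by rewrite integral_set0 => -[<-]; rewrite addr0.
have -> : `]a, c[%classic = (`]a, b[ `|` [set b]) `|` `]b, c[.
  by rewrite setUitv1 ?bnd_simp// -itv_bndbnd_setU// bnd_simp// ltW.
rewrite -(addr0 u); apply: has_integralU fv => //.
- by apply: measurableU.
- apply/disj_setPS => x /= [[|->]]; rewrite /= !in_itv/= ?ltxx// => /andP[_ xb] /andP[bx].
  by rewrite ltNge (ltW xb) in bx.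
apply: has_integralU fu (has_integral_set1 f b) => //.
by apply/disj_setPS => x /= [+ xb]; rewrite xb in_itv/= ltxx andbF.
Qed.

Lemma has_integral_oo_co f v :
  has_integral leb `]0, 1[%classic f v -> has_integral leb I01 f v.
Proof.
move=> fv; rewrite -(@setU1itv _ _ (BLeft (1 : R)) 0 false) ?bnd_simp// -(add0r v).
apply: has_integralU (has_integral_set1 f 0) fv => //.
by apply/disj_setPS => x /= [->]; rewrite in_itv/= ltxx.
Qed.

Lemma has_integral_quadratic c0 c1 c2 a b f v : a <= b ->
  (forall x, a < x < b -> f x = c0 + c1 * x + c2 * x ^+ 2) ->
  v = c0 * (b - a) + c1 * (b ^+ 2 - a ^+ 2) / 2 + c2 * (b ^+ 3 - a ^+ 3) / 3 ->
  has_integral leb `]a, b[%classic f v.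
Proof.
move=> ab fE ->.
pose p : {poly R} := c0 *: 'X + (c1 / 2) *: 'X^2 + (c2 / 3) *: 'X^3.
have := has_integral_deriv p ab; rewrite (_ : _ - _ = c0 * (b - a) +
  c1 * (b ^+ 2 - a ^+ 2) / 2 + c2 * (b ^+ 3 - a ^+ 3) / 3); last first.
  by rewrite /p !hornerE /=; field.
apply: has_integral_ext => // x /=; rewrite in_itv/= => /fE ->.
by rewrite /p !(derivD, derivZ, derivX, derivXn) !(hornerE, hornerMn) /=; field.
Qed.

Lemma per_length_lt (x y : R) : x < y -> per_length x y = y - x.
Proof. by rewrite /per_length => ->. Qed.

Lemma per_length_ge (x y : R) : y <= x -> per_length x y = 1 - x + y.
Proof. by rewrite /per_length ltNge => ->. Qed.

Lemma per_length_ge0 (x y : R) : 0 <= x < 1 -> 0 <= y < 1 -> 0 <= per_length x y.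
Proof. by move=> x1 y1; rewrite /per_length; case: ltP => xy; lra. Qed.

Lemma in_per_intervalT (x y z : R) : 0 <= z < 1 ->
  [\/ x <= z < y, z < y <= x | y <= x <= z] -> in_per_interval x y z.
Proof.
rewrite /in_per_interval => -> [] /andP[h1 h2] /=.
- by rewrite (le_lt_trans h1 h2) h1 h2.
- by rewrite ltNge h2 h1 orbT.
- by rewrite ltNge h1 h2.
Qed.

Lemma in_per_intervalF (x y z : R) :
  [\/ x < y <= z, y <= z < x | z < x < y] -> in_per_interval x y z = false.
Proof.
rewrite /in_per_interval => h; apply/negbTE/negP => /andP[_].
by case: h => /andP[h1 h2]; case: ltP => h3; case: leP => h4; case: ltP => h5 //= _; lra.
Qed.

(* Membership of z in the arc [x, y) is decided by the cyclic order of x, y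
   and z, which has three forms in either case. *)
Local Ltac arc z := first
  [ rewrite (@in_per_intervalT _ _ z); [|lra|by constructor 1; lra]
  | rewrite (@in_per_intervalT _ _ z); [|lra|by constructor 2; lra]
  | rewrite (@in_per_intervalT _ _ z); [|lra|by constructor 3; lra]
  | rewrite (@in_per_intervalF _ _ z); [|by constructor 1; lra]
  | rewrite (@in_per_intervalF _ _ z); [|by constructor 2; lra]
  | rewrite (@in_per_intervalF _ _ z); [|by constructor 3; lra]].

Local Ltac quadratic c0 c1 c2 :=
  apply: (@has_integral_quadratic c0 c1 c2); [lra| |by field].

(** For fixed x the set of admissible y is a union of intervals ending at x, a,
b, 0 or 1: if a <= b, both points lie in [x, y) exactly for y in [0, x] or
(b, 1) when x <= a, for y in (a, x] when a < x <= b, and for y in (b, x] when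
b < x.  The lengths integrate to ((1 - (b - a))^2 + (b - a)^2) / 2. *)
Lemma has_integral2_pair (a b : R) : 0 <= a < 1 -> 0 <= b < 1 ->
  has_integral2 leb I01
    (fun x y => (in_per_interval x y a)%:R * (in_per_interval x y b)%:R)
    (1 / 2 - `|a - b| + `|a - b| ^+ 2).
Proof.
wlog ab : a b / a <= b.
  move=> H a1 b1; have [ab|/ltW ba] := leP a b; first exact: H.
  have := H b a ba b1 a1; rewrite distrC; apply: has_integral2_ext => //.
  by move=> x y _ _; rewrite mulrC.
move=> a1 b1; exists (fun x => if x <= a then x + 1 - b else
                        if x <= b then x - a else x - b); split.
  move=> x; rewrite /= in_itv/= => x1; apply: has_integral_oo_co.
  case: leP => xa; last case: leP => xb.
  - rewrite (_ : x + 1 - b = x + (0 + (1 - b))); last by ring.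
    apply: (@has_integral_cat x); [lra|lra| |apply: (@has_integral_cat b); [lra|lra| |]].
    + by quadratic (1 : R) (0 : R) (0 : R) => y y1; arc a; arc b => /=; ring.
    + by quadratic (0 : R) (0 : R) (0 : R) => y y1; arc b => /=; ring.
    + by quadratic (1 : R) (0 : R) (0 : R) => y y1; arc a; arc b => /=; ring.
  - rewrite (_ : x - a = 0 + (x - a + 0)); last by ring.
    apply: (@has_integral_cat a); [lra|lra| |apply: (@has_integral_cat x); [lra|lra| |]].
    + by quadratic (0 : R) (0 : R) (0 : R) => y y1; arc a => /=; ring.
    + by quadratic (1 : R) (0 : R) (0 : R) => y y1; arc a; arc b => /=; ring.
    + by quadratic (0 : R) (0 : R) (0 : R) => y y1; arc a => /=; ring.
  - rewrite (_ : x - b = 0 + (x - b + 0)); last by ring.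
    apply: (@has_integral_cat b); [lra|lra| |apply: (@has_integral_cat x); [lra|lra| |]].
    + by quadratic (0 : R) (0 : R) (0 : R) => y y1; arc b => /=; ring.
    + by quadratic (1 : R) (0 : R) (0 : R) => y y1; arc a; arc b => /=; ring.
    + by quadratic (0 : R) (0 : R) (0 : R) => y y1; arc b => /=; ring.
apply: has_integral_oo_co; rewrite distrC ger0_norm ?subr_ge0//.
rewrite (_ : 1 / 2 - (b - a) + (b - a) ^+ 2 = (a ^+ 2 / 2 + (1 - b) * a) +
  ((b - a) ^+ 2 / 2 + (1 - b) ^+ 2 / 2)); last by field.
apply: (@has_integral_cat a); [lra|lra| |apply: (@has_integral_cat b); [lra|lra| |]].
- by quadratic (1 - b) (1 : R) (0 : R) => x x1; rewrite ifT; [ring|lra].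
- quadratic (- a) (1 : R) (0 : R) => x x1; rewrite ifF; last by apply/negbTE; lra.
  by rewrite ifT; [ring|lra].
- quadratic (- b) (1 : R) (0 : R) => x x1; rewrite ifF; last by apply/negbTE; lra.
  by rewrite ifF; [ring|apply/negbTE; lra].
Qed.

(** By rotation invariance the value cannot depend on a, hence equals the
integral of the squared length; the explicit computation replaces this
argument. *)
Lemma has_integral2_in_length (a : R) : 0 <= a < 1 ->
  has_integral2 leb I01
    (fun x y => (in_per_interval x y a)%:R * per_length x y) (1 / 3).
Proof.
move=> a1; exists (fun x => if x <= a then 1 / 2 - a ^+ 2 / 2 + a * x - x ^+ 2 / 2
                  else - a - a ^+ 2 / 2 + (1 + a) * x - x ^+ 2 / 2); split.
  move=> x; rewrite /= in_itv/= => x1; apply: has_integral_oo_co.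
  case: leP => xa.
  - rewrite (_ : _ - _ = ((1 - x) * x + x ^+ 2 / 2) +
      (0 + ((1 - a ^+ 2) / 2 - x * (1 - a)))); last by field.
    apply: (@has_integral_cat x); [lra|lra| |apply: (@has_integral_cat a); [lra|lra| |]].
    + quadratic (1 - x) (1 : R) (0 : R) => y y1; arc a.
      by rewrite per_length_ge /=; [ring|lra].
    + by quadratic (0 : R) (0 : R) (0 : R) => y y1; arc a => /=; ring.
    + quadratic (- x) (1 : R) (0 : R) => y y1; arc a.
      by rewrite per_length_lt /=; [ring|lra].
  - rewrite (_ : - a - a ^+ 2 / 2 + (1 + a) * x - x ^+ 2 / 2 =
      0 + (((x - a) * (1 - x) + (x ^+ 2 - a ^+ 2) / 2) + 0)); last by field.
    apply: (@has_integral_cat a); [lra|lra| |apply: (@has_integral_cat x); [lra|lra| |]].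
    + by quadratic (0 : R) (0 : R) (0 : R) => y y1; arc a => /=; ring.
    + quadratic (1 - x) (1 : R) (0 : R) => y y1; arc a.
      by rewrite per_length_ge /=; [ring|lra].
    + by quadratic (0 : R) (0 : R) (0 : R) => y y1; arc a => /=; ring.
apply: has_integral_oo_co.
rewrite (_ : 1 / 3 = (a / 2 - a ^+ 3 / 6) + (1 / 3 - a / 2 + a ^+ 3 / 6)); last by field.
apply: (@has_integral_cat a); [lra|lra| |].
- quadratic (1 / 2 - a ^+ 2 / 2) a (- (1 / 2) : R) => x x1.
  by rewrite ifT; [field|lra].
- quadratic (- a - a ^+ 2 / 2) (1 + a) (- (1 / 2) : R) => x x1.
  by rewrite ifF; [field|apply/negbTE; lra].
Qed.

Lemma has_integral2_length2 :
  has_integral2 leb I01 (fun x y => per_length x y ^+ 2) (1 / 3).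
Proof.
exists (fun=> 1 / 3); split; last first.
  by apply: has_integral_oo_co; quadratic (1 / 3 : R) (0 : R) (0 : R) => x _; ring.
move=> x; rewrite /= in_itv/= => x1; apply: has_integral_oo_co.
rewrite (_ : 1 / 3 = ((1 - x) ^+ 2 * x + (1 - x) * x ^+ 2 + x ^+ 3 / 3) +
  (1 - x) ^+ 3 / 3); last by field.
apply: (@has_integral_cat x); [lra|lra| |].
- quadratic ((1 - x) ^+ 2) (2 * (1 - x)) (1 : R) => y y1.
  by rewrite per_length_ge /=; [ring|lra].
- quadratic (x ^+ 2) (- 2 * x) (1 : R) => y y1.
  by rewrite per_length_lt /=; [ring|lra].
Qed.

End IntervalIntegral.

(** * The periodic discrepancy as a pair energy *)

Section L2perFormula.
Local Open Scope classical_set_scope.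
Local Open Scope ring_scope.
Context (R : realType).
Local Notation mR := (measurableTypeR R).
Local Notation leb := (@lebesgue_measure R).
Local Notation I01 := (`[0, 1[%classic : set mR).

(** The probability that a and b both lie in a uniformly random arc; it is
1/3 + B_2(|a - b|) with B_2 the second Bernoulli polynomial. *)
Definition arc_kernel (a b : R) : R := 1 / 2 - `|a - b| + `|a - b| ^+ 2.

Lemma in_per_boxE d (x y z : d.-tuple R) :
  (in_per_box x y z)%:R = \prod_k (in_per_interval (tnth x k) (tnth y k) (tnth z k))%:R :> R.
Proof.
rewrite /in_per_box; case: forallP => [h|h].
  by rewrite big1// => k _; rewrite h.
have /existsP[k kF] : [exists k, ~~ in_per_interval (tnth x k) (tnth y k) (tnth z k)].
  by rewrite -negb_forall; apply/negP => /forallP.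
by rewrite (bigD1 k)//= (negbTE kF) mul0r.
Qed.

Lemma discrepancyE d (X : {fset d.-tuple R}) x y :
  discrepancy X x y =
  \sum_(p <- X) (in_per_box x y p)%:R - #|` X|%:R * per_volume x y.
Proof.
rewrite /discrepancy; congr (_ - _).
rewrite card_fset_sum1 natr_sum big_fset/= big_mkcond /=.
by apply: eq_bigr => p _; case: ifP.
Qed.

(** Expand (sum_p 1_p - N vol)^2 and integrate the three kinds of products. *)
Lemma L2per_sqr d (X : {fset d.-tuple R}) : [set` X] `<=` @unit_cube R d ->
  L2per X ^+ 2 =
    \sum_(p <- X) \sum_(q <- X) \prod_k arc_kernel (tnth p k) (tnth q k)
      - #|` X|%:R ^+ 2 / 3 ^+ d.
Proof.
move=> Xcube; set V := RHS.
have mC := @measurable_unit_cube R d.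
have X01 p k : p \in X -> 0 <= tnth p k < 1 by move=> /Xcube; exact.
have I01P (x : R) : I01 x -> 0 <= x < 1 by rewrite /= in_itv.
have hV : has_integral2 (lebesgue_tuple R d) (@unit_cube R d)
    (fun x y => discrepancy X x y ^+ 2) V.
  pose inb (p : d.-tuple R) k (x y : R) : R := (in_per_interval x y (tnth p k))%:R.
  have H1 : has_integral2 (lebesgue_tuple R d) (@unit_cube R d)
    (fun x y => \sum_(p <- X) \sum_(q <- X) \prod_k
      (inb p k (tnth x k) (tnth y k) * inb q k (tnth x k) (tnth y k)))
    (\sum_(p <- X) \sum_(q <- X) \prod_k arc_kernel (tnth p k) (tnth q k)).
    apply: has_integral2_sum => // p pX; apply: has_integral2_sum => // q qX.
    apply: (@has_integral2_prod _ _ (fun k x y => inb p k x y * inb q k x y)).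
      by move=> k x y _ _; rewrite mulr_ge0.
    by move=> k; apply: has_integral2_pair; exact: X01.
  have H2 : has_integral2 (lebesgue_tuple R d) (@unit_cube R d)
    (fun x y => \sum_(p <- X) \prod_k
      (inb p k (tnth x k) (tnth y k) * per_length (tnth x k) (tnth y k)))
    (\sum_(p <- X) \prod_(k < d) (1 / 3)).
    apply: has_integral2_sum => // p pX.
    apply: (@has_integral2_prod _ _ (fun k x y => inb p k x y * per_length x y)).
      by move=> k x y /I01P x1 /I01P y1; rewrite mulr_ge0// per_length_ge0.
    by move=> k; apply: has_integral2_in_length; exact: X01.
  have H3 : has_integral2 (lebesgue_tuple R d) (@unit_cube R d)
    (fun x y => \prod_k (per_length (tnth x k) (tnth y k) ^+ 2))
    (\prod_(k < d) (1 / 3)).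
    apply: (@has_integral2_prod _ _ (fun k x y => per_length x y ^+ 2)).
      by move=> k x y _ _; rewrite sqr_ge0.
    by move=> k; exact: has_integral2_length2.
  have := has_integral2D mC (has_integral2D mC H1
    (has_integral2Z (- 2 * #|` X|%:R) mC H2)) (has_integral2Z (#|` X|%:R ^+ 2) mC H3).
  rewrite (_ : _ + _ + _ = V); last first.
    rewrite /V prodr_const card_ord expr_div_n expr1n big_const_seq count_predT iter_addr_0.
    by rewrite -[_ *+ size X]mulr_natl; ring.
  apply: has_integral2_ext => // x y _ _.
  rewrite discrepancyE /per_volume prodrXl.
  set L := \prod_k per_length _ _.
  under [X in X + _ + _]eq_bigr => p _ do under eq_bigr => q _ do
    rewrite big_split /= -!in_per_boxE.
  under [X in _ * X]eq_bigr => p _ do rewrite big_split /= -in_per_boxE.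
  rewrite -mulr_suml; under [X in X + _ + _]eq_bigr => p _ do rewrite -mulr_sumr.
  by rewrite -mulr_suml /= -/L; ring.
rewrite /L2per (has_integral2E hV) sqr_sqrtr//=.
case: hV => g [gD gV]; apply: has_integral_ge0 gV => x xC.
by apply: has_integral_ge0 (gD x xC) => y _; exact: sqr_ge0.
Qed.

End L2perFormula.

(** * Symmetry and pair counts of weak Latin hypercubes *)

Section LatinHypercubes.
Context (M d : nat).
Local Notation cell := {ffun 'I_d -> 'I_M}.
Implicit Types (H : {set cell}) (m p q : cell) (k : 'I_d) (a b : 'I_M).

Definition upd m k a : cell := [ffun j => if j == k then a else m j].

Lemma upd_at m k a : upd m k a k = a.
Proof. by rewrite ffunE eqxx. Qed.

Lemma upd_id m k : upd m k (m k) = m.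
Proof. by apply/ffunP => j; rewrite ffunE; case: eqP => [->|]. Qed.

Lemma upd_upd m k a b : upd (upd m k a) k b = upd m k b.
Proof. by apply/ffunP => j; rewrite !ffunE; case: eqP. Qed.

(** The cardinalities in [weak_latin_hypercube] and [hypercube_mean] are those
of classical sets; finite sets are used for counting. *)
Lemma card_classical_set (T : finType) (P : pred T) :
  #|[set x | P x]%classic| = #|[set x | P x]|.
Proof.
by apply: eq_card => x; rewrite [RHS]inE; apply/idP/idP => [/set_mem|Px]; rewrite ?inE.
Qed.

Lemma latinP H : reflect (forall k m, #|[set a | upd m k a \in H]| = 1)%N
  (weak_latin_hypercube H).
Proof.
apply: (iffP forallP) => h k; [move=> m|apply/forallP => m].
  by rewrite -card_classical_set; have /forallP/(_ m)/eqP := h k.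
by rewrite card_classical_set; apply/eqP; exact: h.
Qed.

Lemma latin_sum1 H k m : weak_latin_hypercube H -> (\sum_a (upd m k a \in H) = 1)%N.
Proof.
move=> /latinP/(_ k m) <-.
by rewrite -sum1dep_card [RHS]big_mkcond; apply: eq_bigr => a _; case: ifP.
Qed.

(** Each line in direction k meets H once, so the M ^ d pairs of a line and a
point on it are counted by H times the M points of a line.  Formally, the
involution (m, a) |-> (m with a in place of m k, m k) exchanges the two
counts. *)
Lemma card_latin k H : (0 < M)%N -> weak_latin_hypercube H -> #|H| = (M ^ d.-1)%N.
Proof.
move=> M0 HL.
have MH : (M * #|H| = M ^ d)%N.
  have -> : (M ^ d = \sum_(m : cell) \sum_(a : 'I_M) (upd m k a \in H))%N.
    under eq_bigr => m _ do rewrite latin_sum1//.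
    by rewrite sum1_card card_ffun !card_ord.
  rewrite pair_big /= (reindex_inj (h := fun ma : cell * 'I_M => (upd ma.1 k ma.2, ma.1 k))) /=.
    under eq_bigr => ma _ do rewrite upd_upd upd_id.
    rewrite -(pair_big xpredT xpredT (fun m (_ : 'I_M) => (m \in H : nat))) /=.
    under eq_bigr => m _ do rewrite sum_nat_const card_ord.
    by rewrite -big_distrr /= -sum1_card [in LHS]big_mkcond.
  apply: (can_inj (g := fun ma : cell * 'I_M => (upd ma.1 k ma.2, ma.1 k))) => -[m a] /=.
  by rewrite upd_upd upd_id upd_at.
have d0 : (0 < d)%N by case: (d) k => // -[].
by apply/eqP; rewrite -(eqn_pmul2l M0) MH -expnS prednK.
Qed.

Definition relabel (s : 'I_d -> {perm 'I_M}) m : cell := [ffun j => s j (m j)].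

Lemma relabelK s : cancel (relabel (fun k => (s k)^-1)%g) (relabel s).
Proof. by move=> m; apply/ffunP => j; rewrite !ffunE permKV. Qed.

Lemma relabel_upd s m k a : relabel s (upd m k a) = upd (relabel s m) k (s k a).
Proof. by apply/ffunP => j; rewrite !ffunE; case: eqP => [->|]. Qed.

Lemma relabel_latin s H :
  weak_latin_hypercube (relabel s @^-1: H) = weak_latin_hypercube H.
Proof.
have lineE k m : #|[set a | upd m k a \in relabel s @^-1: H]| =
    #|[set a | upd (relabel s m) k a \in H]|.
  rewrite -[RHS](card_preimset _ (@perm_inj _ (s k))); apply: eq_card => a.
  by rewrite !inE relabel_upd.
apply/latinP/latinP => h k m; last by rewrite lineE.
by rewrite -(relabelK s m) -lineE.
Qed.

Definition latin_count : nat := #|[set H : {set cell} | weak_latin_hypercube H]|.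

Definition pair_count p q : nat :=
  \sum_(H : {set cell} | weak_latin_hypercube H) (p \in H) * (q \in H).

Lemma pair_count_relabel s p q :
  pair_count (relabel s p) (relabel s q) = pair_count p q.
Proof.
rewrite /pair_count [RHS](reindex_inj (h := fun H => relabel s @^-1: H)).
  by apply: eq_big => [H|H _]; rewrite ?relabel_latin// !inE.
move=> H1 H2 /setP E; apply/setP => m.
by have := E (relabel (fun k => (s k)^-1)%g m); rewrite !inE relabelK.
Qed.

(** The transposition of a and b in coordinate k fixes p. *)
Lemma pair_count_upd p q k a b : a != p k -> b != p k ->
  pair_count p (upd q k a) = pair_count p (upd q k b).
Proof.
move=> ap bp; pose s j := if j == k then tperm a b else 1%g.
rewrite -(pair_count_relabel s); congr pair_count.
  by apply/ffunP => j; rewrite ffunE /s; case: eqP => [->|]; rewrite ?perm1// tpermD.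
rewrite relabel_upd /s eqxx tpermL; apply/ffunP => j; rewrite !ffunE.
by case: eqP => // _; rewrite perm1.
Qed.

(** Given p in H, the line through q in direction k meets H exactly once. *)
Lemma sum_pair_count p q k : (\sum_a pair_count p (upd q k a) = pair_count p p)%N.
Proof.
rewrite exchange_big /=; apply: eq_bigr => H HL.
by rewrite -big_distrr /= latin_sum1// muln1; case: (p \in H).
Qed.

(** The M points of a line are equally likely by symmetry, and exactly one of
them lies in H. *)
Lemma pair_count_diag p k :
  (M * pair_count p p = latin_count)%N.
Proof.
rewrite /latin_count -sum1dep_card.
transitivity (\sum_a pair_count (upd p k a) (upd p k a))%N.
  rewrite -[M in LHS]card_ord -sum_nat_const; apply: eq_bigr => a _.
  pose s j := if j == k then tperm (p k) a else 1%g.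
  rewrite -(pair_count_relabel s) (_ : relabel s p = upd p k a)//.
  apply/ffunP => j; rewrite !ffunE /s; case: eqP => [->|]; first by rewrite tpermL.
  by rewrite perm1.
rewrite exchange_big /=; apply: eq_bigr => H HL; rewrite -(latin_sum1 k p HL).
by apply: eq_bigr => a _; case: (_ \in H).
Qed.

End LatinHypercubes.

(** The cells whose coordinates sum to 0 modulo M. *)
Lemma latin_exists M d : (0 < M)%N ->
  exists H : {set {ffun 'I_d -> 'I_M}}, weak_latin_hypercube H.
Proof.
case: M => // M _; exists [set m : {ffun 'I_d -> 'I_M.+1} | \sum_j m j == 0].
apply/latinP => k m; rewrite -(cards1 (- \sum_(j | j != k) m j)).
apply: eq_card => a; rewrite !inE (bigD1 k)//= ffunE eqxx addr_eq0; congr (_ == - _).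
by apply: eq_bigr => j /negbTE jk; rewrite ffunE jk.
Qed.


Section PairCount.
Context (R : realType) (M d : nat).
Local Notation cell := {ffun 'I_d -> 'I_M}.

(** The factor per coordinate of the deviation from independence of the events
p in H and q in H.  Its sum over b vanishes for M >= 2. *)
Definition latin_weight (a b : 'I_M) : R := if a == b then 1 else - (M%:R - 1)^-1.

(** Induction on the number of coordinates where p and q differ.  Resetting one
of them, say k, to p k gives q' and the recurrence
(M-1) * count(p, q) + count(p, q') = T / M, where T is the number of
hypercubes. *)
Lemma pair_countE (k0 : 'I_d) (p q : cell) :
  (pair_count p q)%:R =
  (latin_count M d)%:R *
  (1 / M%:R ^+ 2 + (M%:R - 1) / M%:R ^+ 2 * \prod_k latin_weight (p k) (q k)) :> R.
Proof.
set T : R := (latin_count M d)%:R.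
have M0 : (M%:R : R) != 0.
  by rewrite pnatr_eq0 -lt0n; case: (M) (p k0) => // -[].
have diagE (m : cell) : (pair_count m m)%:R = T / M%:R :> R.
  by rewrite /T -(pair_count_diag m k0) natrM mulrC mulKf.
have [n] := ubnP #|[set k | p k != q k]|.
elim: n q => // n IH q; rewrite ltnS => pq.
have [/existsP[k pqk]|] := boolP [exists k, p k != q k]; last first.
  rewrite negb_exists => /forallP eq_pq.
  have -> : q = p by apply/ffunP => k; have := eq_pq k; rewrite negbK => /eqP.
  rewrite diagE big1; last by move=> k _; rewrite /latin_weight eqxx.
  by field.
have M1 : (M%:R - 1 : R) != 0.
  rewrite subr_eq0 (eqr_nat _ M 1); apply: contra pqk => /eqP M1.
  by apply/eqP/val_inj => /=; have := ltn_ord (p k); have := ltn_ord (q k); lia.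
pose q' := upd q k (p k).
have q'k : q' k = p k by rewrite upd_at.
have q'j j : j != k -> q' j = q j by move=> jk; rewrite ffunE (negbTE jk).
have lt_pq' : (#|[set j | p j != q' j]| < n)%N.
  apply: leq_trans pq; apply: proper_card; apply/properP; split.
    apply/fintype.subsetP => j; rewrite !inE; have [->|jk] := eqVneq j k; first by rewrite q'k eqxx.
    by rewrite q'j.
  by exists k; rewrite !inE ?q'k ?eqxx.
have /(congr1 (fun n => n%:R : R)) := sum_pair_count p q k.
rewrite (bigD1 (p k))//= (eq_bigr (fun=> pair_count p q)); last first.
  by move=> a ap; rewrite -[in RHS](upd_id q k); apply: pair_count_upd; rewrite // eq_sym.
rewrite sum_nat_const natrD natrM diagE -/q' (IH _ lt_pq').
rewrite (_ : #|_|%:R = M%:R - 1); last first.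
  rewrite (@eq_card _ _ (predC1 (p k)))// cardC1 card_ord -subn1 natrB//.
  by rewrite lt0n -(pnatr_eq0 R).
pose P := \prod_(j | j != k) latin_weight (p j) (q j).
have -> : \prod_j latin_weight (p j) (q' j) = P.
  rewrite (bigD1 k)//= q'k /latin_weight eqxx mul1r.
  by apply: eq_bigr => j jk; rewrite q'j.
have -> : \prod_j latin_weight (p j) (q j) = - (M%:R - 1)^-1 * P.
  by rewrite (bigD1 k)//= {1}/latin_weight (negbTE pqk).
move=> E; apply: (mulfI M1).
rewrite -[LHS](addKr (T * (1 / M%:R ^+ 2 + (M%:R - 1) / M%:R ^+ 2 * P))) E.
by field; rewrite M1 M0.
Qed.

End PairCount.

(** * The mean discrepancy *)

Section Mean.
Context (R : realType) (M d : nat).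
Local Notation cell := {ffun 'I_d -> 'I_M}.
Context (M0 : (0 < M)%N).
Let MR0 : (M%:R : R) != 0. Proof. by rewrite pnatr_eq0 -lt0n. Qed.

Definition grid_kernel (a b : 'I_M) : R := arc_kernel (a%:R / M%:R) (b%:R / M%:R).

(** The instance x = a with n = M or n = a sums the kernel over the grid: the
absolute value only changes the sign of the linear term, for b < a. *)
Lemma sum_quadratic (n : nat) (x c1 c2 : R) :
  \sum_(i < n) (c1 * (x - i%:R) + c2 * (x - i%:R) ^+ 2) =
  c1 * (n%:R * x - n%:R * (n%:R - 1) / 2) +
  c2 * (n%:R * x ^+ 2 - x * n%:R * (n%:R - 1) + n%:R * (n%:R - 1) * (2 * n%:R - 1) / 6).
Proof.
elim: n => [|n IH]; first by rewrite big_ord0; field.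
by rewrite big_ord_recr /= IH -natr1; field.
Qed.

Lemma sum_grid_kernel (a : 'I_M) :
  \sum_b grid_kernel a b = (2 * M%:R ^+ 2 + 1) / (6 * M%:R).
Proof.
have kE (b : 'I_M) : grid_kernel a b = 1 / 2 + (M%:R^-1 * (a%:R - b%:R)
      + M%:R ^- 2 * (a%:R - b%:R) ^+ 2) +
    (if (b < a)%N then - 2 / M%:R * (a%:R - b%:R) + 0 * (a%:R - b%:R) ^+ 2 else 0).
  rewrite /grid_kernel /arc_kernel -mulrBl normrM (ger0_norm (x := _^-1))//.
  case: ltnP => ab.
    by rewrite ger0_norm; [field|rewrite subr_ge0 ler_nat ltnW].
  by rewrite ler0_norm; [field|rewrite subr_le0 ler_nat].
under eq_bigr => b _ do rewrite kE.
rewrite big_split big_split /= sum_quadratic sumr_const card_ord.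
rewrite -big_mkcond /= -(big_ord_widen _
  (fun b => - 2 / M%:R * (a%:R - b%:R) + 0 * (a%:R - b%:R) ^+ 2)).
  by rewrite sum_quadratic -[_ *+ M]mulr_natl; field.
exact/ltnW.
Qed.

Lemma grid_kernel_diag (a : 'I_M) : grid_kernel a a = 1 / 2.
Proof. by rewrite /grid_kernel /arc_kernel subrr normr0; ring. Qed.

(** Only the diagonal value 1/2 and the total [sum_grid_kernel] matter, since
the weight is constant off the diagonal. *)
Lemma sum_weighted_grid_kernel (a : 'I_M) : (M != 1)%N ->
  \sum_b grid_kernel a b * latin_weight R a b = (M%:R + 1) / (6 * M%:R).
Proof.
move=> M1; have M1R : (M%:R - 1 : R) != 0 by rewrite subr_eq0 (eqr_nat _ M 1).
have := sum_grid_kernel a; rewrite (bigD1 a)//= => sumE.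
rewrite (bigD1 a)//= {1}/latin_weight eqxx mulr1.
rewrite (eq_bigr (fun b => grid_kernel a b * - (M%:R - 1)^-1)); last first.
  by move=> b ba; rewrite /latin_weight eq_sym (negbTE ba).
rewrite -mulr_suml -[X in X * _](addKr (grid_kernel a a)) sumE grid_kernel_diag.
by field; rewrite M1R MR0.
Qed.

Lemma sum_prod_pair (f : 'I_M -> 'I_M -> R) c : (forall a, \sum_b f a b = c) ->
  \sum_(p : cell) \sum_(q : cell) \prod_k f (p k) (q k) = (M%:R * c) ^+ d.
Proof.
move=> fc.
transitivity (\sum_(p : cell) c ^+ d).
  apply: eq_bigr => p _; rewrite -(bigA_distr_bigA (fun k b => f (p k) b)).
  by under eq_bigr => k _ do rewrite fc; rewrite prodr_const card_ord.
by rewrite sumr_const card_ffun !card_ord -[LHS]mulr_natl natrX exprMn.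
Qed.

Lemma hypercube_point_inj :
  injective (fun m : cell => [tuple (m k : nat)%:R / M%:R | k < d] : d.-tuple R).
Proof.
move=> m m' mm'; apply/ffunP => k; apply/val_inj.
have := congr1 (fun t => tnth t k) mm'; rewrite !tnth_mktuple.
by move/(divIf MR0)/eqP; rewrite eqr_nat => /eqP.
Qed.

Lemma big_hypercube_points (H : {set cell}) (F : d.-tuple R -> R) :
  \sum_(x <- hypercube_points R H) F x =
  \sum_(m in H) F [tuple (m k : nat)%:R / M%:R | k < d].
Proof.
rewrite big_imfset; first by rewrite big_enum.
by move=> m m' _ _; exact: hypercube_point_inj.
Qed.

Lemma card_hypercube_points (H : {set cell}) : #|` hypercube_points R H|%fset = #|H|.
Proof. by rewrite card_imfset ?cardE//; exact: hypercube_point_inj. Qed.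

Lemma hypercube_points_cube (H : {set cell}) :
  ([set` hypercube_points R H] `<=` @unit_cube R d)%classic.
Proof.
move=> x /= /imfsetP[m _ ->] k; rewrite tnth_mktuple divr_ge0//=.
by rewrite ltr_pdivrMr ?ltr0n// mul1r ltr_nat.
Qed.

Lemma L2per_latin (k0 : 'I_d) (H : {set cell}) : weak_latin_hypercube H ->
  L2per (hypercube_points R H) ^+ 2 =
  \sum_(p in H) \sum_(q in H) \prod_k grid_kernel (p k) (q k)
    - (M%:R ^+ d.-1) ^+ 2 / 3 ^+ d.
Proof.
move=> HL; rewrite L2per_sqr; last exact: hypercube_points_cube.
rewrite card_hypercube_points (card_latin k0 M0 HL) natrX big_hypercube_points.
congr (_ - _); apply: eq_bigr => p _; rewrite big_hypercube_points.
apply: eq_bigr => q _; apply: eq_bigr => k _.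
by rewrite !tnth_mktuple.
Qed.

Lemma latin_count_gt0 : (0 < latin_count M d)%N.
Proof.
by have [H HL] := latin_exists d M0; apply/card_gt0P; exists H; rewrite inE.
Qed.

Lemma sum_latin_pairs (k0 : 'I_d) (W : cell -> cell -> R) :
  \sum_(H : {set cell} | weak_latin_hypercube H) \sum_(p in H) \sum_(q in H) W p q =
  (latin_count M d)%:R * (1 / M%:R ^+ 2 * \sum_p \sum_q W p q +
    (M%:R - 1) / M%:R ^+ 2 *
      \sum_p \sum_q W p q * \prod_k latin_weight R (p k) (q k)).
Proof.
transitivity (\sum_p \sum_q W p q * (pair_count p q)%:R).
  transitivity (\sum_(H : {set cell} | weak_latin_hypercube H) \sum_p \sum_q
      W p q * ((p \in H) * (q \in H))%N%:R).
    apply: eq_bigr => H _; rewrite big_mkcond; apply: eq_bigr => p _.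
    case: (p \in H); last by rewrite big1// => q _; rewrite mulr0.
    rewrite big_mkcond; apply: eq_bigr => q _.
    by case: (q \in H); rewrite ?mulr1 ?mulr0.
  rewrite exchange_big /=; apply: eq_bigr => p _.
  rewrite exchange_big /=; apply: eq_bigr => q _.
  by rewrite -mulr_sumr -natr_sum.
rewrite mulrDr !mulrA !mulr_sumr -big_split /=; apply: eq_bigr => p _.
rewrite !mulr_sumr -big_split /=; apply: eq_bigr => q _.
by rewrite (pair_countE R k0); ring.
Qed.

Lemma hypercube_mean_L2per (k0 : 'I_d) :
  hypercube_mean (fun H : {set cell} => L2per (hypercube_points R H) ^+ 2) =
    ((M%:R - 1) * (M%:R + 1) ^+ d + (2 * M%:R ^+ 2 + 1) ^+ d
      - 2 ^+ d * M%:R ^+ (2 * d)) / (6 ^+ d * M%:R ^+ 2).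
Proof.
have d0 : (0 < d)%N by case: (d) k0 => // -[].
have T0 : ((latin_count M d)%:R : R) != 0 by rewrite pnatr_eq0 -lt0n latin_count_gt0.
rewrite /hypercube_mean card_classical_set -/(latin_count M d).
under eq_bigr => H HL do rewrite (L2per_latin k0 HL).
rewrite sumrB (sum_latin_pairs k0).
rewrite [X in _ - X](eq_bigl (mem [set H : {set cell} | weak_latin_hypercube H])); last first.
  by move=> H; rewrite !inE.
rewrite sumr_const -/(latin_count M d) -[X in _ - X]mulr_natl -mulrBr mulrAC divff// mul1r.
rewrite (sum_prod_pair sum_grid_kernel) [X in _ + X - _]mulrAC.
have -> : (M%:R - 1) * \sum_(p : cell) \sum_(q : cell)
    (\prod_k grid_kernel (p k) (q k) * \prod_k latin_weight R (p k) (q k)) =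
    (M%:R - 1) * ((M%:R + 1) / 6) ^+ d.
  (* For M = 1 the weights degenerate, but their total factor M - 1 is 0. *)
  have [M1|M1] := eqVneq M 1%N.
    by rewrite (_ : M%:R - 1 = 0 :> R) ?mul0r// {1}M1 subrr.
  congr (_ * _).
  under eq_bigr => p _ do under eq_bigr => q _ do rewrite -big_split /=.
  rewrite (sum_prod_pair (fun a => sum_weighted_grid_kernel a M1)).
  by congr (_ ^+ d); field; rewrite MR0.
have -> : M%:R * ((2 * M%:R ^+ 2 + 1) / (6 * M%:R)) = (2 * M%:R ^+ 2 + 1) / 6 :> R.
  by field; rewrite MR0.
rewrite !expr_div_n (_ : 6 = 2 * 3 :> R); last by ring.
rewrite (_ : M%:R ^+ (2 * d) = (M%:R ^+ d.-1) ^+ 2 * M%:R ^+ 2 :> R); last first.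
  by rewrite -!exprM -exprD; congr (_ ^+ _); lia.
rewrite exprMn; field.
by rewrite MR0 !expf_neq0// pnatr_eq0.
Qed.

End Mean.

(** * Asymptotics and existence *)

Section Existence.
Context (R : realType).

Lemma exists_le_hypercube_mean M d (f : {set {ffun 'I_d -> 'I_M}} -> R) :
  (0 < M)%N -> exists2 H, weak_latin_hypercube H & f H <= hypercube_mean f.
Proof.
move=> M0; have [H0 H0L] := latin_exists d M0.
have [H HL Hmin] := arg_minP f H0L; exists H => //.
rewrite /hypercube_mean card_classical_set -/(latin_count M d).
rewrite ler_pdivlMr ?ltr0n ?latin_count_gt0// /latin_count -sum1dep_card natr_sum mulr_sumr.
by apply: ler_sum => H' H'L; rewrite mulr1; exact: Hmin.
Qed.

Local Notation horner_ops :=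
  (hornerZ, hornerD, hornerN, hornerM, hornerC, hornerX, hornerXn, horner_exp, horner_sum).

(** The mean divided by its leading term d / (2 * 3^d) * M^(2d-4), as a
polynomial in 1/M.  The sum is ((2 + X^2)^d - 2^d) / X^2, written without the
quotient so that it can be evaluated at 0. *)
Definition ratio_poly d : {poly R} :=
  (d%:R * 2 ^+ d.-1)^-1 *: ('X^(d - 3) * (1%:P - 'X) * (1%:P + 'X) ^+ d +
    \sum_(i < d) ('X^2 + 2%:P) ^+ (d.-1 - i) * 2%:P ^+ i).

Lemma horner_ratio_poly d (t : R) : t != 0 ->
  (ratio_poly d).[t] = (d%:R * 2 ^+ d.-1)^-1 *
    (t ^+ (d - 3) * (1 - t) * (1 + t) ^+ d + ((t ^+ 2 + 2) ^+ d - 2 ^+ d) / t ^+ 2).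
Proof.
move=> t0; rewrite /ratio_poly !horner_ops; congr (_ * (_ + _)).
rewrite subrXX addrK mulrAC divff ?mul1r ?expf_neq0//.
by apply: eq_bigr => i _; rewrite !horner_ops.
Qed.

Lemma mean_formulaE d (x : R) : (3 <= d)%N -> x != 0 ->
  ((x - 1) * (x + 1) ^+ d + (2 * x ^+ 2 + 1) ^+ d - 2 ^+ d * x ^+ (2 * d))
    / (6 ^+ d * x ^+ 2) =
  d%:R / (2 * 3 ^+ d) * (x ^+ (d - 2)) ^+ 2 * (ratio_poly d).[x^-1].
Proof.
case: d => [|[|[|e]]]// _ x0.
have t0 : x^-1 != 0 by rewrite invr_eq0.
rewrite horner_ratio_poly// -{1 2 3 4 5 6}[x]invrK; move: (x^-1) t0 => {x x0} t t0.
have -> : t^-1 + 1 = (1 + t) / t by field.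
have -> : 2 * t^-1 ^+ 2 + 1 = (t ^+ 2 + 2) / t ^+ 2 by field.
have -> : 6 = 2 * 3 :> R by ring.
have -> : (e.+3 - 3 = e)%N by rewrite -addn3 addnK.
have -> : (e.+3 - 2 = e.+1)%N by rewrite subn2.
rewrite /= !expr_div_n !exprVn exprM !exprMn.
have -> : t ^+ e.+1 = t ^+ e * t by rewrite exprSr.
have -> : t ^+ e.+3 = t ^+ e * t ^+ 3 by rewrite -exprD addn3.
have -> : 2 ^+ e.+2 = 4 * 2 ^+ e :> R by rewrite !exprS; ring.
have -> : 2 ^+ e.+3 = 8 * 2 ^+ e :> R by rewrite !exprS; ring.
have n0 : (e.+3%:R : R) != 0 by rewrite pnatr_eq0.
have two0 : (2 ^+ e : R) != 0 by rewrite expf_neq0// pnatr_eq0.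
have three0 : (3 ^+ e.+3 : R) != 0 by rewrite expf_neq0// pnatr_eq0.
have te0 : (t ^+ e : R) != 0 by rewrite expf_neq0.
move: (e.+3%:R) (2 ^+ e) (3 ^+ e.+3) (t ^+ e) n0 two0 three0 te0 => n A B T n0 A0 B0 T0.
move: ((1 + t) ^+ _) ((t ^+ 2 + 2) ^+ _) => u w.
by field; rewrite t0 T0 n0 A0 B0.
Qed.

(** This is where d >= 4 enters: for d = 3 the first summand, coming from
(M-1)(M+1)^d, is of the same order as the leading term. *)
Lemma ratio_poly0 d : (4 <= d)%N -> (ratio_poly d).[0] = 1.
Proof.
move=> d4; rewrite /ratio_poly !horner_ops.
rewrite expr0n (_ : (d - 3 == 0)%N = false) ?mul0r ?add0r; last by lia.
rewrite (eq_bigr (fun=> 2 ^+ d.-1)).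
  rewrite sumr_const card_ord -(mulr_natl (2 ^+ d.-1)) mulVf//.
  rewrite mulf_neq0 ?pnatr_eq0 ?expf_neq0 ?pnatr_eq0//.
  by lia.
move=> i _; rewrite !horner_ops mul0r add0r -exprD.
by congr (_ ^+ _); have := ltn_ord i; lia.
Qed.

(** The argument N^(-1/(d-1)) extends 1/M from N = M^(d-1) to all N. *)
Definition relative_error d (N : nat) : R :=
  Num.sqrt (ratio_poly d).[N%:R^-1 `^ (d%:R - 1)^-1] - 1.

Local Open Scope classical_set_scope.

Lemma cvg_relative_error d : (4 <= d)%N -> relative_error d N @[N --> \oo] --> (0 : R).
Proof.
move=> d4; have d1 : 0 < (d%:R - 1 : R)^-1 by rewrite invr_gt0 subr_gt0 ltr1n; lia.
have inv0 : (N%:R^-1 : R) @[N --> \oo] --> 0^'+.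
  have lim0 : (N%:R^-1 : R) @[N --> \oo] --> (0 : R).
    by rewrite -cvg_shiftS; exact: cvg_harmonic.
  move=> P P0; change (\forall N \near \oo, P (N%:R^-1)).
  have PN : \forall N \near \oo, 0 < (N%:R^-1 : R) -> P (N%:R^-1) := lim0 _ P0.
  near=> N; apply: (near PN N) => //.
  by rewrite invr_gt0 ltr0n; near: N; exists 1%N.
have root0 := cvg_comp _ _ inv0 (powR_cvg0 d1).
have : Num.sqrt (ratio_poly d).[N%:R^-1 `^ (d%:R - 1)^-1] @[N --> \oo] -->
    Num.sqrt (ratio_poly d).[0].
  apply: (@cvg_comp _ _ _ _ Num.sqrt); last exact: sqrt_continuous.
  apply: (@cvg_comp _ _ _ _ (horner (ratio_poly d))); last exact: continuous_horner.
  exact: root0.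
rewrite ratio_poly0// sqrtr1 => lim1; rewrite -(subrr 1).
by apply: cvgB lim1 _; exact: cvg_cst.
Unshelve. all: by end_near.
Qed.

End Existence.

Local Open Scope classical_set_scope.
Local Open Scope ring_scope.

Theorem theorem4p3 (R : realType) :
  (forall M d : nat, (1 <= M)%N -> (2 <= d)%N ->
    hypercube_mean (fun H : {set {ffun 'I_d -> 'I_M}} =>
      L2per (hypercube_points R H) ^+ 2) =
    ((M%:R - 1) * (M%:R + 1) ^+ d + (2 * M%:R ^+ 2 + 1) ^+ d
      - 2 ^+ d * M%:R ^+ (2 * d)) / (6 ^+ d * M%:R ^+ 2)) /\
  (exists o : nat -> nat -> R,
    (forall d : nat, (4 <= d)%N -> o d N @[N --> \oo] --> (0 : R)) /\
    (forall d M : nat, (4 <= d)%N -> (1 <= M)%N ->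
      exists H : {set {ffun 'I_d -> 'I_M}},
        let X := hypercube_points R H in
        let N := (M ^ (d - 1))%N in
        [/\ weak_latin_hypercube H,
            [set` X] `<=` @unit_cube R d,
            #|` X|%fset = N
          & L2per X <= Num.sqrt (d%:R / (2 * 3 ^+ d)) * (1 + o d N)
                       * N%:R `^ ((d%:R - 2) / (d%:R - 1))])).
Proof.
split=> [M [//|d] M1 _|]; first by apply: hypercube_mean_L2per => //; exact: ord0.
exists (@relative_error R); split=> [d d4|d M d4 M1]; first exact: cvg_relative_error.
have k0 : 'I_d by case: d d4 => // d _; exact: ord0.
have [H HL Hle] := exists_le_hypercube_mean
  (fun H : {set {ffun 'I_d -> 'I_M}} => L2per (hypercube_points R H) ^+ 2) M1.
have MR0 : (M%:R : R) != 0 by rewrite pnatr_eq0 -lt0n.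
have d1 : (d%:R - 1 : R) != 0 by rewrite subr_eq0 (eqr_nat _ d 1); lia.
have rootN : (M ^ (d - 1))%:R `^ (d%:R - 1)^-1 = M%:R :> R.
  rewrite natrX -powR_mulrn// -powRrM natrB; last by lia.
  by rewrite mulfV// powRr1.
exists H; split => //.
- exact: hypercube_points_cube.
- by rewrite card_hypercube_points// (card_latin k0)// subn1.
have rootVN : (M ^ (d - 1))%:R^-1 `^ (d%:R - 1)^-1 = M%:R^-1 :> R.
  by rewrite -[_%:R^-1]powR_inv1// -powRrM mulrC powRrM rootN powR_inv1.
rewrite /relative_error [1 + _]addrC subrK rootVN.
rewrite [X in _ <= _ * X](_ : _ = M%:R ^+ (d - 2)); last first.
  by rewrite mulrC powRrM rootN -powR_mulrn// natrB//; lia.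
move: Hle; rewrite hypercube_mean_L2per// mean_formulaE//; last by lia.
move=> Hle.
set C := d%:R / _ in Hle *; set g := _.[_] in Hle *.
have C0 : 0 <= C by rewrite divr_ge0// mulr_ge0// exprn_ge0.
rewrite -[L2per _]ger0_norm ?sqrtr_ge0// -sqrtr_sqr.
apply: le_trans (ler_wsqrtr Hle) _.
rewrite sqrtrM; last by rewrite mulr_ge0// exprn_ge0.
by rewrite sqrtrM// sqrtr_sqr ger0_norm ?exprn_ge0// mulrAC.
Qed.
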